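(* Let $\lambda^*$ be the optimal value of the problem $(\mathrm{P})$: $\inf\{f_1(x)/f_2(x): x\in X\}$, and let $x^*$ be an optimal solution of $(\mathrm{P})$. Suppose that the pair $(\lambda^*,x^* )$ satisfies: $f(\lambda^* )=0$, $A_1-\lambda^*A_2\succeq 0$, $(A_1-\lambda^*A_2)x^*=-(b_1-\lambda^*b_2)$, and $u\le g(x^* )\le v$. Then $$\lambda^*=\sup\left\{\lambda\in\mathbb{R}:\begin{pmatrix}A_1-\lambda A_2 & b_1-\lambda b_2\\ b_1^T-\lambda b_2^T & c_1-\lambda c_2\end{pmatrix}\succeq 0\right\}.$$
   Context: For $i=1,2$ let $f_i(x)=x^TA_ix+2b_i^Tx+c_i$ and let $g(x)=x^TBx+2d^Tx+\alpha$ be functions on $\mathbb{R}^n$, where $A_1,A_2,B$ are real symmetric $n\times n$ matrices (possibly indefinite), $b_1,b_2,d\in\mathbb{R}^n$ and $c_1,c_2,\alpha\in\mathbb{R}$. Let $X=\{x\in\mathbb{R}^n: u\le g(x)\le v\}\neq\emptyset$. Standing assumptions: $(\mathrm{P})$ is well-defined, i.e. $f_2(x)>0$ for all $x\in X$; $(\mathrm{P})$ is attained, i.e. its infimum $\lambda^*$ is a finite real number attained at some point of $X$; and $\inf_{x\in\mathbb{R}^n}g(x)<u\le v<\sup_{x\in\mathbb{R}^n}g(x)$. For $\lambda\in\mathbb{R}$ put $f(\lambda)=\inf\{f_1(x)-\lambda f_2(x): x\in X\}$. The notation $M\succeq 0$ means that the symmetric matrix $M$ is positive semidefinite. *)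

(* Defs.v *)
From HB Require Import structures.
From mathcomp Require Import all_boot all_order all_algebra.
From mathcomp Require Import all_classical all_reals ereal.

Set Implicit Arguments.
Unset Strict Implicit.
Unset Printing Implicit Defensive.

Import Order.TTheory GRing.Theory Num.Theory.
Local Open Scope classical_set_scope.
Local Open Scope ring_scope.

(* x^T A x + 2 b^T x + c; the matrix products are 1 x 1 matrices, hence the
   entry (0, 0). *)
Definition quad (R : realType) (n : nat) (A : 'M[R]_n) (b : 'cV[R]_n) (c : R)
    (x : 'cV[R]_n) : R :=
  (x^T *m A *m x) 0 0 + 2 * (b^T *m x) 0 0 + c.

Definition psdmx (R : realType) (m : nat) (M : 'M[R]_m) : Prop :=
  M \is symmetricmx /\ forall y : 'cV[R]_m, 0 <= (y^T *m M *m y) 0 0.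

Definition feasible (R : realType) (n : nat) (g : 'cV[R]_n -> R) (u v : R)
    : set 'cV[R]_n :=
  [set x | u <= g x <= v].

(* Infima and suprema are taken in the extended reals: over R itself, the
   library's [inf] and [sup] take a default value on empty or unbounded sets. *)
Definition inf_on (R : realType) (T : Type) (X : set T) (h : T -> R) : \bar R :=
  ereal_inf [set (h x)%:E | x in X].

Definition sup_on (R : realType) (T : Type) (X : set T) (h : T -> R) : \bar R :=
  ereal_sup [set (h x)%:E | x in X].

Definition attained (R : realType) (T : Type) (X : set T) (h : T -> R) : Prop :=
  exists2 x, X x & inf_on X h = (h x)%:E.

Definition optimal_solution (R : realType) (T : Type) (X : set T) (h : T -> R)
    (x : T) : Prop :=
  X x /\ forall y, X y -> h x <= h y.

Definition fratio (R : realType) (T : Type) (f1 f2 : T -> R) (x : T) : R :=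
  f1 x / f2 x.

(* The function f(lambda) = inf {f1(x) - lambda f2(x) : x in X}. *)
Definition param_inf (R : realType) (T : Type) (X : set T) (f1 f2 : T -> R)
    (lam : R) : \bar R :=
  inf_on X (fun x => f1 x - lam * f2 x).

Definition pencil_mx (R : realType) (n : nat) (A1 A2 : 'M[R]_n)
    (b1 b2 : 'cV[R]_n) (c1 c2 lam : R) : 'M[R]_(n + 1) :=
  block_mx (A1 - lam *: A2)         (b1 - lam *: b2)
           (b1^T - lam *: b2^T)     (c1 - lam * c2)%:M.

(* Main.v *)
(* Put A = A1 - lam A2, b = b1 - lam b2, c = c1 - lam c2.  Since A xs = - b and the
   quadratic function with data (A, b, c) vanishes at xs, the pencil at lam is the
   congruence [1 | - xs]^T A [1 | - xs], hence positive semidefinite.  Conversely,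
   if the pencil at l is positive semidefinite, its form at (xs, 1), which is
   f1 xs - l f2 xs, is nonnegative, so l <= f1 xs / f2 xs = lam. *)
Require Import Defs.
From HB Require Import structures.
From mathcomp Require Import all_boot all_order all_algebra.
From mathcomp Require Import all_classical all_reals ereal.
From mathcomp Require Import ring lra.

Import Order.TTheory GRing.Theory Num.Theory.
Local Open Scope classical_set_scope.
Local Open Scope ring_scope.

Set Implicit Arguments.
Unset Strict Implicit.

Lemma symmetricmxP (R : realType) (n : nat) (A : 'M[R]_n) :
  reflect (A^T = A) (A \is symmetricmx).
Proof.
rewrite is_hermitianmxE expr0 scale1r map_mx_id // eq_sym; exact: eqP.
Qed.

(** Bridges the order-theoretic notion of a minimizer and the extended-real infimum; it serves to
    identify [lam] with the ratio at [xs]. *)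
Lemma inf_on_optimal_solution (R : realType) (T : Type) (X : set T) (h : T -> R)
    (x : T) :
  optimal_solution X h x -> inf_on X h = (h x)%:E.
Proof.
move=> [Xx hx]; apply/le_anti/andP; split; first by apply: ereal_inf_lbound; exists x.
by apply: le_ereal_inf_tmp => _ [y Xy <-]; rewrite lee_fin hx.
Qed.

Lemma quad_subZ (R : realType) (n : nat) (A1 A2 : 'M[R]_n) (b1 b2 : 'cV[R]_n)
    (c1 c2 l : R) (x : 'cV[R]_n) :
  quad (A1 - l *: A2) (b1 - l *: b2) (c1 - l * c2) x =
  quad A1 b1 c1 x - l * quad A2 b2 c2 x.
Proof.
rewrite /quad [(b1 - _)^T]linearB /= [(_ *: b2)^T]linearZ /= mulmxBr !mulmxBl.
by rewrite -scalemxAr -!scalemxAl !mxE; ring.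
Qed.

(** Exhibits the lower left block as the transpose of the upper right one, the shape shared by the
    two bordered-matrix lemmas below. *)
Lemma pencil_mxE (R : realType) (n : nat) (A1 A2 : 'M[R]_n) (b1 b2 : 'cV[R]_n)
    (c1 c2 l : R) (b := b1 - l *: b2) :
  pencil_mx A1 A2 b1 b2 c1 c2 l =
  block_mx (A1 - l *: A2) b b^T (c1 - l * c2)%:M.
Proof. by rewrite /pencil_mx /b [(b1 - _)^T]linearB /= [(_ *: b2)^T]linearZ. Qed.

(** The off-diagonal blocks contribute [x^T *m b] and [b^T *m x], equal as 1 x 1 transposes of each
    other, whence the factor 2 in [quad]. *)
Lemma bordered_form (R : realType) (n : nat) (A : 'M[R]_n) (b : 'cV[R]_n) (c : R)
    (x : 'cV[R]_n) (y := col_mx x 1%:M) :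
  (y^T *m block_mx A b b^T c%:M *m y) 0 0 = quad A b c x.
Proof.
rewrite /y /quad tr_col_mx trmx1 mul_row_block mul_row_col !mul1mx mulmx1 mulmxDl.
by rewrite -[x^T *m b]trmxK trmx_mul trmxK !mxE eqxx mulr1n; ring.
Qed.

Lemma psdmx_congr (R : realType) (m n : nat) (A : 'M[R]_n) (P : 'M[R]_(n, m)) :
  psdmx A -> psdmx (P^T *m A *m P).
Proof.
move=> [/symmetricmxP symA psdA]; split.
  by apply/symmetricmxP; rewrite !trmx_mul trmxK symA mulmxA.
by move=> y; have := psdA (P *m y); rewrite trmx_mul !mulmxA.
Qed.

(** The blocks of [P^T *m A *m P] are [A], [- A *m x], its transpose, and [x^T *m A *m x];
    stationarity turns the off-diagonal ones into [b] and [b^T]. *)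
Lemma bordered_congr (R : realType) (n : nat) (A : 'M[R]_n) (b : 'cV[R]_n) (c : R)
    (x : 'cV[R]_n) (P := row_mx 1%:M (- x)) :
  A \is symmetricmx -> A *m x = - b -> quad A b c x = 0 ->
  block_mx A b b^T c%:M = P^T *m A *m P.
Proof.
move=> /symmetricmxP symA Ax qx0.
have xA : x^T *m A = - b^T by rewrite -[in LHS]symA -trmx_mul Ax linearN.
(* By [xA], the quadratic term of [quad A b c x] is minus [b^T *m x], half of the linear term, so
   its vanishing reads [b^T *m x + c = 0]. This settles the corner block. *)
have bxE : b^T *m x = - c%:M.
  rewrite [LHS]mx11_scalar -rmorphN; congr _%:M.
  by move: qx0; rewrite /quad xA mulNmx [X in X + _ + _]mxE; lra.
rewrite /P tr_row_mx trmx1 linearN /= mul_col_mx mul_col_row mul1mx !mulNmx xA.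
by rewrite !mulNmx !opprK !mulmx1 !mulmxN Ax bxE !opprK.
Qed.

Unset Implicit Arguments.

Theorem theorem2p3 (R : realType) (n : nat)
    (A1 A2 B : 'M[R]_n) (b1 b2 d : 'cV[R]_n) (c1 c2 alpha u v : R)
    (f1 := quad A1 b1 c1) (f2 := quad A2 b2 c2) (g := quad B d alpha)
    (X := feasible g u v)
    (symA1 : A1 \is symmetricmx) (symA2 : A2 \is symmetricmx)
    (symB : B \is symmetricmx)
    (X_neq0 : X !=set0)
    (f2_gt0 : forall x, X x -> 0 < f2 x)
    (P_attained : attained X (fratio f1 f2))
    (inf_lt_u : (inf_on [set: 'cV[R]_n] g < u%:E)%E)
    (le_uv : u <= v)
    (v_lt_sup : (v%:E < sup_on [set: 'cV[R]_n] g)%E)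
    (lam : R) (xs : 'cV[R]_n)
    (lam_opt : inf_on X (fratio f1 f2) = lam%:E)
    (xs_opt : optimal_solution X (fratio f1 f2) xs)
    (f_lam : param_inf X f1 f2 lam = 0%E)
    (psd_lam : psdmx (A1 - lam *: A2))
    (stat_xs : (A1 - lam *: A2) *m xs = - (b1 - lam *: b2))
    (feas_xs : u <= g xs <= v) :
  lam%:E =
    ereal_sup [set l%:E | l in
                [set l : R | psdmx (pencil_mx A1 A2 b1 b2 c1 c2 l)]].
Proof.
have xsE : fratio f1 f2 xs = lam.
  by apply: EFin_inj; rewrite -lam_opt (inf_on_optimal_solution xs_opt).
have f2xs : 0 < f2 xs by apply: f2_gt0.
apply/le_anti/andP; split.
  (* [lam] itself belongs to the set, so the supremum is attained there. *)
  apply: ereal_sup_ubound; exists lam => //=.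
  rewrite pencil_mxE (@bordered_congr _ _ _ _ _ xs psd_lam.1 stat_xs).
    exact: psdmx_congr.
  (* The value at [xs] is [f1 xs - lam * f2 xs], which is zero because [lam] is the ratio at [xs]
     and [f2 xs] is nonzero. *)
  by rewrite quad_subZ -/f1 -/f2 -xsE /fratio divfK ?subrr ?gt_eqF.
apply: ge_ereal_sup => _ [l [_ psd_l] <-].
have := psd_l (col_mx xs 1%:M); rewrite pencil_mxE bordered_form quad_subZ subr_ge0.
by rewrite lee_fin -xsE /fratio ler_pdivlMr.
Qed.
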